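(* Let $(\mathcal{T}_r)_{r\in\mathbb{Z}}$ be a sequence of complex numbers satisfying $\mathcal{T}_r=\mathcal{T}_{r-1}+\mathcal{T}_{r-2}+\mathcal{T}_{r-3}$ for all integers $r$. Then for every integer $r$: \[ \mathcal{T}_r^2 - 2\mathcal{T}_{r-1}^2 - 3\mathcal{T}_{r-2}^2 - 6\mathcal{T}_{r-3}^2 + \mathcal{T}_{r-4}^2 + \mathcal{T}_{r-6}^2 = 0, \] \[ \mathcal{T}_{r+2}^2 - 4\mathcal{T}_{r+1}^2 + \mathcal{T}_r^2 + 14\mathcal{T}_{r-2}^2 - 4\mathcal{T}_{r-3}^2 - 2\mathcal{T}_{r-4}^2 - 8\mathcal{T}_{r-5}^2 + \mathcal{T}_{r-6}^2 + \mathcal{T}_{r-8}^2 = 0, \] \[ \mathcal{T}_{r+3}^2 - 3\mathcal{T}_{r+2}^2 - 4\mathcal{T}_r^2 + 2\mathcal{T}_{r-1}^2 - 10\mathcal{T}_{r-2}^2 - 4\mathcal{T}_{r-3}^2 + \mathcal{T}_{r-5}^2 + \mathcal{T}_{r-6}^2 = 0, \] \[ \mathcal{T}_{r+1}^2 - 4\mathcal{T}_r^2 + 2\mathcal{T}_{r-2}^2 + 16\mathcal{T}_{r-3}^2 + 4\mathcal{T}_{r-4}^2 - 2\mathcal{T}_{r-6}^2 - \mathcal{T}_{r-7}^2 = 0, \] \[ \mathcal{T}_{r+2}^2 - 2\mathcal{T}_{r+1}^2 - 2\mathcal{T}_r^2 - 8\mathcal{T}_{r-1}^2 - 2\mathcal{T}_{r-2}^2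 - 6\mathcal{T}_{r-3}^2 + 2\mathcal{T}_{r-4}^2 + \mathcal{T}_{r-6}^2 = 0. \]
   Context: A generalized Tribonacci sequence is determined by arbitrary initial values $\mathcal{T}_0,\mathcal{T}_1,\mathcal{T}_2$ and the recurrence $\mathcal{T}_r=\mathcal{T}_{r-1}+\mathcal{T}_{r-2}+\mathcal{T}_{r-3}$, extended to all integer indices (equivalently, the recurrence holds for all $r\in\mathbb{Z}$). *)

(* Defs.v *)
From Stdlib Require Export ZArith Reals.
From Coquelicot Require Export Coquelicot.

Definition generalized_tribonacci (T : Z -> C) : Prop :=
  forall r : Z, T r = (T (r - 1)%Z + T (r - 2)%Z + T (r - 3)%Z)%C.

(* Main.v *)
Require Import Defs.
From Stdlib Require Import Lia.

(** Three consecutive values determine the whole sequence linearly. Written through [T (r - 6)],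
    [T (r - 7)], [T (r - 8)], each left-hand side is a quadratic form in three free variables, and
    its six coefficients all cancel. *)

Theorem theorem1 (T : Z -> C) (hT : generalized_tribonacci T) (r : Z) :
  (T r ^ 2 - 2 * T (r - 1)%Z ^ 2 - 3 * T (r - 2)%Z ^ 2 - 6 * T (r - 3)%Z ^ 2
   + T (r - 4)%Z ^ 2 + T (r - 6)%Z ^ 2 = 0)%C /\
  (T (r + 2)%Z ^ 2 - 4 * T (r + 1)%Z ^ 2 + T r ^ 2 + 14 * T (r - 2)%Z ^ 2
   - 4 * T (r - 3)%Z ^ 2 - 2 * T (r - 4)%Z ^ 2 - 8 * T (r - 5)%Z ^ 2
   + T (r - 6)%Z ^ 2 + T (r - 8)%Z ^ 2 = 0)%C /\
  (T (r + 3)%Z ^ 2 - 3 * T (r + 2)%Z ^ 2 - 4 * T r ^ 2 + 2 * T (r - 1)%Z ^ 2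
   - 10 * T (r - 2)%Z ^ 2 - 4 * T (r - 3)%Z ^ 2 + T (r - 5)%Z ^ 2
   + T (r - 6)%Z ^ 2 = 0)%C /\
  (T (r + 1)%Z ^ 2 - 4 * T r ^ 2 + 2 * T (r - 2)%Z ^ 2 + 16 * T (r - 3)%Z ^ 2
   + 4 * T (r - 4)%Z ^ 2 - 2 * T (r - 6)%Z ^ 2 - T (r - 7)%Z ^ 2 = 0)%C /\
  (T (r + 2)%Z ^ 2 - 2 * T (r + 1)%Z ^ 2 - 2 * T r ^ 2 - 8 * T (r - 1)%Z ^ 2
   - 2 * T (r - 2)%Z ^ 2 - 6 * T (r - 3)%Z ^ 2 + 2 * T (r - 4)%Z ^ 2
   + T (r - 6)%Z ^ 2 = 0)%C.
Proof.
  (* Passing the indices as equations keeps them in the form [r - k], instead of nested shifts such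
     as [r - 1 - 3], so that later rewrites match syntactically. *)
  assert (step : forall a b c d : Z, b = (a - 1)%Z -> c = (a - 2)%Z ->
    d = (a - 3)%Z -> T a = (T b + T c + T d)%C)
    by (intros a b c d -> -> ->; apply hT).
  (* Descending order matters: each rewrite introduces only smaller indices, so no eliminated term
     returns. The descent stops at [r - 8], the lowest index in the five identities. *)
  rewrite (step (r + 3)%Z (r + 2)%Z (r + 1)%Z r) by lia.
  rewrite (step (r + 2)%Z (r + 1)%Z r (r - 1)%Z) by lia.
  rewrite (step (r + 1)%Z r (r - 1)%Z (r - 2)%Z) by lia.
  rewrite (step r (r - 1)%Z (r - 2)%Z (r - 3)%Z) by lia.
  rewrite (step (r - 1)%Z (r - 2)%Z (r - 3)%Z (r - 4)%Z) by lia.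
  rewrite (step (r - 2)%Z (r - 3)%Z (r - 4)%Z (r - 5)%Z) by lia.
  rewrite (step (r - 3)%Z (r - 4)%Z (r - 5)%Z (r - 6)%Z) by lia.
  rewrite (step (r - 4)%Z (r - 5)%Z (r - 6)%Z (r - 7)%Z) by lia.
  rewrite (step (r - 5)%Z (r - 6)%Z (r - 7)%Z (r - 8)%Z) by lia.
  repeat split; ring.
Qed.
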